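(* (The $n$-variable mates correspondence.) Let $F_0,\ldots,F_n$ and $F_0',\ldots,F_n'$ be two $n$-variable left adjunctions, on categories $A_0,\ldots,A_n$ and $A_0',\ldots,A_n'$ respectively, and let $S_l\colon A_l\to A_l'$ be functors for $0\le l\le n$. Let $i,j,k\in\{0,\ldots,n\}$ be distinct, and let $$\alpha\colon S_i^\bullet F_i\Rightarrow F_i'(S_{i+1}\times\cdots\times S_{i-1})$$ be a natural transformation of functors $A_{i+1}\times\cdots\times A_{i-1}\to A_i'^\bullet$. Then $$(\alpha_{ij})_{jk}=\alpha_{ik}.$$
   Context: $A^\bullet$ denotes the opposite category of $A$, and $S^\bullet$ the opposite functor of $S$. Indices $0,\ldots,n$ are taken cyclically mod $n+1$; $\hat a_i$ denotes the string $a_{i+1},\ldots,a_n,a_0,\ldots,a_{i-1}$, and $F(\hat{a}_i)$, $A_{i+1}\times\cdots\times A_{i-1}$, $S_{i+1}\times\cdots\times S_{i-1}$ use the same cyclic ordering. An $n$-variable left adjunction consists of categories $A_0,\ldots,A_n$; functors $F_i\colon A_{i+1}\times\cdots\times A_{i-1}\to A_i^\bullet$ for $0\le i\le n$; and isomorphisms $A_{i-1}(F_{i-1}(\hat a_{i-1}),a_{i-1})\cong A_i(F_i(\hat a_i),a_i)$ for all $i$ (cyclically), natural in all variables, such that going once around the cycle of these $n+1$ isomorphisms is the identity. Composing them gives well-defined isomorphisms $A_i(F_i(\hat a_i),a_i)\cong A_j(F_j(\hat a_j),a_j)$ for all $i\ne j$. Mates: given $\alpha\colon S_i^\bullet F_i\Rightarrow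 F_i'(S_{i+1}\times\cdots\times S_{i-1})$, i.e. components $F_i'(S_{i+1}a_{i+1},\ldots,S_{i-1}a_{i-1})\to S_iF_i(\hat a_i)$ in $A_i'$, and $j\neq i$, the mate $\alpha_{ij}\colon S_j^\bullet F_j\Rightarrow F_j'(S_{j+1}\times\cdots\times S_{j-1})$ is the natural transformation of functors $A_{j+1}\times\cdots\times A_{j-1}\to A_j'^\bullet$ obtained by fixing all variables except $a_i,a_j$ and taking the 1-variable mate. Explicitly, its component $F_j'(S_{j+1}a_{j+1},\ldots,S_{j-1}a_{j-1})\to S_jF_j(\hat a_j)$ is the morphism corresponding, under the isomorphism $A_i'(F_i'(\ldots),S_ia_i)\cong A_j'(F_j'(\ldots),S_jF_j(\hat a_j))$ (all other variables being $S_la_l$), to the composite $$F_i'(\ldots,S_jF_j(\hat a_j),\ldots)\xrightarrow{\alpha}S_iF_i(\ldots,F_j(\hat a_j),\ldots)\xrightarrow{S_i\varepsilon}S_ia_i,$$ where $F_j(\hat a_j)$ is placed in the $A_j$-variable, the remaining variables are $S_la_l$ (resp. $a_l$) for $l\ne i,j$, and $\varepsilon\colon F_i(\ldots,F_j(\hat a_j),\ldots)\to a_i$ corresponds to the identity of $F_j(\hat a_j)$ under $A_i(F_i(\hat a_i),a_i)\cong A_j(F_j(\hat a_j),a_j)$. *)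

(* Defs.v *)
From Stdlib Require Import FunctionalExtensionality ProofIrrelevance.
From mathcomp Require Import all_boot.

Set Implicit Arguments.
Unset Strict Implicit.
Unset Printing Implicit Defensive.

Declare Scope cat_scope.
Delimit Scope cat_scope with cat.
Local Open Scope cat_scope.

Record category := Category {
  obj :> Type;
  hom : obj -> obj -> Type;
  idm : forall a, hom a a;
  compm : forall a b c, hom b c -> hom a b -> hom a c;
  comp1m : forall a b (f : hom a b), compm (idm b) f = f;
  compm1 : forall a b (f : hom a b), compm f (idm a) = f;
  compmA : forall a b c d (f : hom c d) (g : hom b c) (h : hom a b),
    compm f (compm g h) = compm (compm f g) h }.

Arguments hom {_} _ _.
Arguments idm {_} _.
Arguments compm {_ _ _ _} _ _.

Notation "g \o f" := (compm g f) : cat_scope.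

Record functor (C D : category) := Functor {
  fobj :> C -> D;
  fmap : forall a b : C, hom a b -> hom (fobj a) (fobj b);
  fmap1 : forall a : C, fmap (idm a) = idm (fobj a);
  fmapM : forall (a b c : C) (g : hom b c) (f : hom a b),
    fmap (g \o f) = fmap g \o fmap f }.

Arguments fmap {C D} _ {a b} _.

Record nattrans (C D : category) (F G : functor C D) := Nattrans {
  ncomp :> forall a : C, hom (F a) (G a);
  natural : forall (a b : C) (f : hom a b),
    fmap G f \o ncomp a = ncomp b \o fmap F f }.

Definition op (C : category) : category :=
  @Category C (fun a b => @hom C b a) (fun a => idm a)
    (fun a b c g f => @compm C c b a f g)
    (fun a b f => compm1 f) (fun a b f => comp1m f)
    (fun a b c d f g h => esym (compmA h g f)).

Definition op_functor (C D : category) (F : functor C D) :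
    functor (op C) (op D) :=
  @Functor (op C) (op D) F (fun a b f => @fmap C D F b a f)
    (fun a => fmap1 F a) (fun a b c g f => fmapM F f g).

Definition comp_functor (C D E : category) (G : functor D E)
    (F : functor C D) : functor C E.
Proof.
refine (@Functor C E (fun a => G (F a)) (fun a b f => fmap G (fmap F f)) _ _).
- by move=> a; rewrite !fmap1.
- by move=> a b c g f; rewrite !fmapM.
Defined.

Definition prod_cat (I : Type) (A : I -> category) : category.
Proof.
refine (@Category (forall l, A l) (fun a b => forall l, hom (a l) (b l))
  (fun a l => idm (a l)) (fun a b c g f l => g l \o f l) _ _ _).
- by move=> a b f; apply: functional_extensionality_dep => l; rewrite comp1m.
- by move=> a b f; apply: functional_extensionality_dep => l; rewrite compm1.
- move=> a b c d f g h; apply: functional_extensionality_dep => l.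
  exact: compmA.
Defined.

Definition prod_functor (I : Type) (A B : I -> category)
    (S : forall l, functor (A l) (B l)) : functor (prod_cat A) (prod_cat B).
Proof.
refine (@Functor (prod_cat A) (prod_cat B) (fun a l => S l (a l))
  (fun a b f l => fmap (S l) (f l)) _ _).
- by move=> a; apply: functional_extensionality_dep => l; exact: fmap1.
- move=> a b c g f; apply: functional_extensionality_dep => l; exact: fmapM.
Defined.

Definition id_hom (C : category) (a b : C) (e : a = b) : hom a b :=
  match e with erefl => idm a end.

Lemma id_homK (C : category) (a b : C) (e : a = b) :
  id_hom (esym e) \o id_hom e = idm a.
Proof. by case: b / e; rewrite comp1m. Qed.

Lemma id_homVK (C : category) (a b : C) (e : a = b) :
  id_hom e \o id_hom (esym e) = idm b.
Proof. by case: b / e; rewrite comp1m. Qed.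

Lemma id_hom1 (C : category) (a : C) (e : a = a) : id_hom e = idm a.
Proof. by rewrite (proof_irrelevance _ e erefl). Qed.

Section Cyclic.
Context {n : nat}.
Implicit Types (A : 'I_n.+1 -> category) (i j : 'I_n.+1).

(* The string a_{i+1}, ..., a_{i-1} is encoded as a family indexed by the
   l != i, so [hat_cat A i] is A_{i+1} x ... x A_{i-1}. *)
Definition others i : Type := {l : 'I_n.+1 | l != i}.

Definition hat_cat A i : category :=
  prod_cat (fun l : others i => A (sval l)).

Definition hat_functor A (A' : 'I_n.+1 -> category)
    (S : forall l, functor (A l) (A' l)) i :
    functor (hat_cat A i) (hat_cat A' i) :=
  prod_functor (fun l : others i => S (sval l)).

Definition hat A i (a : prod_cat A) : hat_cat A i := fun l => a (sval l).
Arguments hat {A} i a.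

Definition hat_map A i (a b : prod_cat A) (f : hom a b) :
    hom (hat i a) (hat i b) := fun l => f (sval l).
Arguments hat_map {A} i {a b} f.

Notation op_family A := (forall i, functor (hat_cat A i) (op (A i))).

Definition fmap_op (C D : category) (F : functor C (op D)) (a b : C)
    (f : hom a b) : @hom D (F b) (F a) := fmap F f.

(* The set A_i(F_i(\hat a_i), a_i) and its functoriality in the full tuple a:
   covariant in every variable, because F_i takes values in the opposite. *)
Definition cohom A (F : op_family A) (a : prod_cat A) i : Type :=
  @hom (A i) (F i (hat i a)) (a i).

Definition cohom_map A (F : op_family A) (a b : prod_cat A) (f : hom a b) i
    (x : cohom F a i) : cohom F b i :=
  f i \o (x \o fmap_op (F i) (hat_map i f)).

(* One step of the cycle of isomorphisms, acting on the disjoint union over i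
   of the sets A_i(F_i(\hat a_i), a_i); "once around the cycle is the identity"
   can then be stated without transport along i + (n + 1) = i. *)
Definition cycle_step A (F : op_family A)
    (phi : forall a i, cohom F a i -> cohom F a (ordS i)) (a : prod_cat A)
    (u : {i & cohom F a i}) : {i & cohom F a i} :=
  Tagged (cohom F a) (phi a (tag u) (tagged u)).

Record left_adjunction A := LeftAdjunction {
  ladj :> op_family A;
  ladj_iso : forall a i, cohom ladj a i -> cohom ladj a (ordS i);
  ladj_iso_bij : forall a i, bijective (@ladj_iso a i);
  ladj_iso_natural : forall (a b : prod_cat A) (f : hom a b) i
      (x : cohom ladj a i),
    ladj_iso (cohom_map f x) = cohom_map f (ladj_iso x);
  ladj_cycle : forall a (u : {i & cohom ladj a i}),
    iter n.+1 (@cycle_step A ladj ladj_iso a) u = u }.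

(* The number of steps of the cycle leading from i to j. *)
Definition steps i j : nat := (j + (n.+1 - i)) %% n.+1.

Lemma tag_iter_cycle_step A (F : op_family A)
    (phi : forall a i, cohom F a i -> cohom F a (ordS i)) a u k :
  tag (iter k (cycle_step phi (a := a)) u) = (tag u + k) %% n.+1 :> nat.
Proof.
elim: k => [|k IHk] /=; first by rewrite addn0 modn_small.
by rewrite IHk -addn1 modnDml addn1 addnS.
Qed.

Lemma tag_steps A (F : op_family A)
    (phi : forall a i, cohom F a i -> cohom F a (ordS i)) a i j
    (x : cohom F a i) :
  tag (iter (steps i j) (cycle_step phi (a := a)) (Tagged (cohom F a) x)) = j.
Proof.
apply: val_inj; rewrite /= tag_iter_cycle_step /= /steps modnDmr addnCA.
by rewrite subnKC ?(ltnW (ltn_ord i)) // modnDr modn_small.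
Qed.

(* The composite isomorphism
   A_i(F_i(\hat a_i), a_i) -> A_j(F_j(\hat a_j), a_j). *)
Definition transpose A (F : left_adjunction A) (a : prod_cat A) i j
    (x : cohom F a i) : cohom F a j :=
  etagged (tag_steps (@ladj_iso A F) j x).

(* The full tuple with x in place j and b elsewhere. Its entries are only
   propositionally those of x and b, hence the identities [put_at] and
   [put_hat] below. *)
Definition put A j (x : A j) (b : hat_cat A j) : prod_cat A :=
  fun l => match eqVneq l j with
           | EqNotNeq e => eq_rect_r (fun l => obj (A l)) x e
           | NeqNotEq h => b (exist _ l h)
           end.

Lemma put_atE A j (x : A j) (b : hat_cat A j) : put x b j = x.
Proof.
by rewrite /put; case: eqVneq => [e|/eqP//]; rewrite (eq_axiomK e).
Qed.

Lemma put_hatE A j (x : A j) (b : hat_cat A j) (l : others j) :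
  put x b (sval l) = b l.
Proof.
case: l => l h; rewrite /put /=; case: eqVneq => [e|h'].
  by exfalso; rewrite e eqxx in h.
by rewrite (bool_irrelevance h' h).
Qed.

Definition put_at A j (x : A j) (b : hat_cat A j) : hom (put x b j) x :=
  id_hom (put_atE x b).
Definition put_at_inv A j (x : A j) (b : hat_cat A j) : hom x (put x b j) :=
  id_hom (esym (put_atE x b)).
Definition put_hat A j (x : A j) (b : hat_cat A j) :
    hom (hat j (put x b)) b :=
  fun l => id_hom (put_hatE x b l).
Definition put_hat_inv A j (x : A j) (b : hat_cat A j) :
    hom b (hat j (put x b)) :=
  fun l => id_hom (esym (put_hatE x b l)).

Definition put_map A j (x y : A j) (b c : hat_cat A j) (f : hom x y)
    (g : hom b c) : hom (put x b) (put y c) :=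
  fun l => match eqVneq l j as t return
      hom (match t with
           | EqNotNeq e => eq_rect_r (fun l => obj (A l)) x e
           | NeqNotEq h => b (exist _ l h)
           end)
          (match t with
           | EqNotNeq e => eq_rect_r (fun l => obj (A l)) y e
           | NeqNotEq h => c (exist _ l h)
           end) with
    | EqNotNeq e => match esym e as e' in _ = l0 return
        hom (eq_rect j (fun l => obj (A l)) x l0 e')
            (eq_rect j (fun l => obj (A l)) y l0 e') with erefl => f end
    | NeqNotEq h => g (exist _ l h)
    end.

Lemma put_map_at A j (x y : A j) (b c : hat_cat A j) (f : hom x y)
    (g : hom b c) :
  put_at y c \o put_map f g j = f \o put_at x b.
Proof.
rewrite /put_at; move: (put_atE x b) (put_atE y c).
rewrite /put /put_map; case: eqVneq => [e|/eqP//].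
rewrite (eq_axiomK e) /= => ex ey.
by rewrite !id_hom1 comp1m compm1.
Qed.

Lemma put_map_hat A j (x y : A j) (b c : hat_cat A j) (f : hom x y)
    (g : hom b c) :
  put_hat y c \o hat_map j (put_map f g) = g \o put_hat x b.
Proof.
have main l (h : l != j) (ex : put x b l = b (exist _ l h))
    (ey : put y c l = c (exist _ l h)) :
    id_hom ey \o put_map f g l = g (exist _ l h) \o id_hom ex.
  move: ex ey; rewrite /put /put_map; case: eqVneq => [e|h'].
    by exfalso; rewrite e eqxx in h.
  rewrite (bool_irrelevance h' h) => ex ey.
  by rewrite !id_hom1 comp1m compm1.
by apply: functional_extensionality_dep => -[l h]; exact: main.
Qed.

Lemma put_atVK A j (x : A j) (b : hat_cat A j) :
  put_at x b \o put_at_inv x b = idm x.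
Proof. exact: id_homVK. Qed.

Lemma put_atK A j (x : A j) (b : hat_cat A j) :
  put_at_inv x b \o put_at x b = idm _.
Proof. exact: id_homK. Qed.

Lemma put_hatVK A j (x : A j) (b : hat_cat A j) :
  put_hat x b \o put_hat_inv x b = idm b.
Proof. by apply: functional_extensionality_dep => l; exact: id_homVK. Qed.

Lemma put_hatK A j (x : A j) (b : hat_cat A j) :
  put_hat_inv x b \o put_hat x b = idm _.
Proof. by apply: functional_extensionality_dep => l; exact: id_homK. Qed.

Lemma put_map_at_inv A j (x y : A j) (b c : hat_cat A j) (f : hom x y)
    (g : hom b c) :
  put_map f g j \o put_at_inv x b = put_at_inv y c \o f.
Proof.
rewrite -[LHS]comp1m -(put_atK y c) -compmA (compmA (put_at y c)).
by rewrite put_map_at -(compmA f) put_atVK compm1.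
Qed.

Lemma put_map_hat_inv A j (x y : A j) (b c : hat_cat A j) (f : hom x y)
    (g : hom b c) :
  hat_map j (put_map f g) \o put_hat_inv x b = put_hat_inv y c \o g.
Proof.
rewrite -[LHS]comp1m -(put_hatK y c) -compmA (compmA (put_hat y c)).
by rewrite put_map_hat -(compmA g) put_hatVK compm1.
Qed.

Lemma fmap_opM (C D : category) (G : functor C (op D)) (a b c : C)
    (g : hom b c) (f : hom a b) :
  fmap_op G (g \o f) = fmap_op G f \o fmap_op G g.
Proof. exact: (fmapM G). Qed.

Lemma transpose_natural A (F : left_adjunction A) (a b : prod_cat A)
    (f : hom a b) i j (x : cohom F a i) :
  transpose j (cohom_map f x) = cohom_map f (transpose j x).
Proof.
rewrite /transpose.
move: (tag_steps (@ladj_iso A F) j x)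
  (tag_steps (@ladj_iso A F) j (cohom_map f x)).
set u := iter _ _ _; set v := iter _ _ _.
have -> : v = Tagged (cohom F b) (cohom_map f (tagged u)).
  rewrite /u /v; elim: (steps i j) => [//|k IHk] /=.
  by rewrite {1}IHk /cycle_step /= ladj_iso_natural.
move: u {v} => [k y] /= p q; rewrite (proof_irrelevance _ q p).
by rewrite /etagged; case: j / p {q}.
Qed.

(* The identity of F_j(b), as an element of A_j(F_j(\hat c_j), c_j) for the
   tuple c = put (F_j(b)) b; its transpose at i is the counit
   F_i(..., F_j(b), ...) -> b_i. *)
Definition id_cohom A (F : op_family A) j (b : hat_cat A j) :
    cohom F (put (F j b : A j) b) j :=
  put_at_inv (F j b : A j) b
    \o fmap_op (F j) (put_hat_inv (F j b : A j) b).

Definition counit A (F : left_adjunction A) i j (b : hat_cat A j) :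
    cohom F (put (F j b : A j) b) i :=
  transpose i (id_cohom F b).

Section Mates.
Context {A A' : 'I_n.+1 -> category}.
Context (F : left_adjunction A) (F' : left_adjunction A').
Context (S : forall l, functor (A l) (A' l)).

(* Natural transformations S_i^op F_i => F'_i (S_{i+1} x ... x S_{i-1}). *)
Definition mate_cell i : Type :=
  nattrans (comp_functor (op_functor (S i)) (F i))
           (comp_functor (F' i) (hat_functor S i)).

(* The component F'_i(S \hat a_i) -> S_i F_i(\hat a_i) of such a cell, as a
   morphism of A'_i. *)
Definition cell_comp i (alpha : mate_cell i) (a : hat_cat A i) :
    @hom (A' i) (F' i (hat_functor S i a)) (S i (F i a : A i)) :=
  alpha a.

Definition cell_act i (alpha : mate_cell i) (a : prod_cat A)
    (x : cohom F a i) : cohom F' (prod_functor S a) i :=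
  fmap (S i) x \o cell_comp alpha (hat i a).

Definition mate_comp i (alpha : mate_cell i) j (b : hat_cat A j) :
    @hom (A' j) (F' j (hat_functor S j b)) (S j (F j b : A j)) :=
  fmap (S j) (put_at (F j b : A j) b)
  \o (transpose j (cell_act alpha (counit F i b))
  \o fmap_op (F' j) (fmap (hat_functor S j) (put_hat (F j b : A j) b))).

Lemma cell_act_natural i (alpha : mate_cell i) (a b : prod_cat A)
    (f : hom a b) (x : cohom F a i) :
  cell_act alpha (cohom_map f x) =
  cohom_map (fmap (prod_functor S) f) (cell_act alpha x).
Proof.
rewrite /cell_act /cohom_map !fmapM -!compmA; congr (_ \o (_ \o _)).
exact: esym (natural alpha (hat_map i f)).
Qed.

Lemma mate_comp_natural i (alpha : mate_cell i) j (b c : hat_cat A j)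
    (f : hom b c) :
  mate_comp alpha b \o fmap_op (F' j) (fmap (hat_functor S j) f) =
  fmap (S j) (fmap_op (F j) f) \o mate_comp alpha c.
Proof.
pose x : A j := F j b; pose y : A j := F j c.
pose p := put_map (idm x) f.
pose q := put_map (fmap_op (F j) f : @hom (A j) y x) (idm c).
have Epq : cohom_map p (id_cohom F b) = cohom_map q (id_cohom F c).
  rewrite /cohom_map /id_cohom /p /q /x /y.
  rewrite -!compmA -!fmap_opM !put_map_hat_inv !compmA.
  by rewrite !(put_map_at_inv (A := A)) !compm1 fmap_opM compmA.
pose Y (d : hat_cat A j) := transpose j (cell_act alpha (counit F i d)).
have EY : cohom_map (fmap (prod_functor S) p) (Y b) =
          cohom_map (fmap (prod_functor S) q) (Y c).
  by rewrite -!transpose_natural -!cell_act_natural -!transpose_natural Epq.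
rewrite /mate_comp -/(Y b) -/(Y c) -/x -/y.
have E1 : put_at x b = put_at x c \o p j by rewrite put_map_at comp1m.
have E2 : fmap_op (F j) f \o put_at y c = put_at x c \o q j.
  by rewrite put_map_at.
have E3 : f \o put_hat x b = put_hat x c \o hat_map j p.
  by rewrite put_map_hat.
have E4 : put_hat y c = put_hat x c \o hat_map j q.
  by rewrite put_map_hat comp1m.
rewrite -!compmA -fmap_opM -(fmapM (hat_functor S j)) E3 E1.
rewrite [RHS]compmA -(fmapM (S j)) E2 E4.
rewrite !fmapM !fmap_opM.
have := congr1 (fun z => fmap (S j) (put_at x c) \o
  (z \o fmap_op (F' j) (fmap (hat_functor S j) (put_hat x c)))) EY.
by rewrite /cohom_map -!compmA.
Qed.

Definition mate i (alpha : mate_cell i) j : mate_cell j :=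
  @Nattrans _ _ (comp_functor (op_functor (S j)) (F j))
    (comp_functor (F' j) (hat_functor S j))
    (fun b => mate_comp alpha b)
    (fun b c f => mate_comp_natural alpha f).

End Mates.
End Cyclic.

Arguments hat {n A} i a.
Arguments hat_map {n A} i {a b} f.

(* Main.v *)
Require Import Defs.
From Stdlib Require Import FunctionalExtensionality ProofIrrelevance.
From mathcomp Require Import all_boot.

(** Write [x : cohom F a i] for a morphism out of [F i] applied to the other
    variables; a cell [alpha] acts on such morphisms by
    [x |-> S_i x \o alpha], which is [cell_act alpha].  The mate of [alpha] is
    defined only through its value at the counit, but the Yoneda argument shows
    that it is characterized by the square
      [cell_act (mate alpha j) (transpose j x) = transpose j (cell_act alpha x)]
    for every tuple [a] and every [x] ([cell_act_mate]): any element of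
    [cohom F a j] is the image of the identity of [F j] under a morphism of
    tuples ([cohom_map_id_cohom]), and both sides of the square are natural.

    The cycle condition makes transposition functorial: going from [i] to [j]
    and then to [k] is going from [i] to [k] ([transpose_trans]), since the two
    routes differ by a number of full turns.  Both mates at [k] start from the
    identity of [F k], transposed to [j] for [mate (mate alpha j) k] and to [i]
    for [mate alpha k]; these two counits are therefore transposes of one
    another.  By the square, letting [mate alpha j] act on the counit at [j]
    gives the transpose from [i] to [j] of [alpha] acting on the counit at [i];
    transposing further from [j] to [k] gives its transpose from [i] to [k],
    which is what defines [mate alpha k]. *)

Set Implicit Arguments.
Unset Strict Implicit.
Unset Printing Implicit Defensive.

Local Open Scope cat_scope.

Lemma nattrans_eq (C D : category) (G H : functor C D) (s t : nattrans G H) :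
  (forall c, s c = t c) -> s = t.
Proof.
case: s t => [s Ns] [t Nt] /= st.
have Est : s = t by exact: functional_extensionality_dep.
by case: t / Est Nt {st} => Nt; rewrite (proof_irrelevance _ Ns Nt).
Qed.

Section Transpose.
Context {n : nat} (A : 'I_n.+1 -> category) (F : left_adjunction A).
Implicit Types (a : prod_cat A) (i j k : 'I_n.+1).

Local Notation turn a := (cycle_step (@ladj_iso n A F) (a := a)).

(** In the disjoint union over all indices, transposition is iteration of one
    map, so that composites of transposes can be compared without any
    transport between indices. *)
Lemma Tagged_transpose a i j (x : cohom F a i) :
  Tagged (cohom F a) (transpose j x) =
  iter (steps i j) (turn a) (Tagged (cohom F a) x).
Proof.
rewrite /transpose; move: (tag_steps _ _ _).
by case: (iter _ _ _) => l y /= e; case: j / e.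
Qed.

Lemma iter_turn_modn a m (u : {i & cohom F a i}) :
  iter (m %% n.+1) (turn a) u = iter m (turn a) u.
Proof.
rewrite [in RHS](divn_eq m n.+1) addnC iterD; congr (iter _ _ _).
by elim: (m %/ n.+1) => [//|q IHq]; rewrite mulSn iterD -IHq ladj_cycle.
Qed.

Lemma steps_trans i j k : steps i j + steps j k = steps i k %[mod n.+1].
Proof.
rewrite /steps modn_mod modnDm (addnC k) addnACA.
by rewrite subnKC ?(ltnW (ltn_ord j)) // modnDl addnC.
Qed.

Lemma transpose_trans a i j k (x : cohom F a i) :
  transpose k (transpose j x) = transpose k x.
Proof.
apply: (inj_pair2 _ (cohom F a) k).
rewrite -!/(Tagged (cohom F a) _) !Tagged_transpose -iterD addnC.
by rewrite -iter_turn_modn steps_trans iter_turn_modn.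
Qed.

Lemma transpose_id a i (x : cohom F a i) : transpose i x = x.
Proof.
apply: (inj_pair2 _ (cohom F a) i).
rewrite -!/(Tagged (cohom F a) _) Tagged_transpose /steps.
by rewrite subnKC ?(ltnW (ltn_ord i)) // modnn.
Qed.

End Transpose.

Section Yoneda.
Context {n : nat} (A : 'I_n.+1 -> category).
Implicit Types (a b : prod_cat A) (j : 'I_n.+1).

(** A morphism of tuples may be prescribed separately at [j] and at the
    other indices. *)
Definition glue a b j (u : hom (a j) (b j)) (v : hom (hat j a) (hat j b)) :
    hom a b :=
  fun l => match eqVneq l j with
           | EqNotNeq e => match esym e in _ = l0 return hom (a l0) (b l0) with
                           | erefl => u
                           end
           | NeqNotEq h => v (exist _ l h)
           end.

Lemma glue_at a b j (u : hom (a j) (b j)) (v : hom (hat j a) (hat j b)) :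
  glue u v j = u.
Proof. by rewrite /glue; case: eqVneq => [e|/eqP//]; rewrite (eq_axiomK e). Qed.

Lemma glue_hat a b j (u : hom (a j) (b j)) (v : hom (hat j a) (hat j b)) :
  hat_map j (glue u v) = v.
Proof.
apply: functional_extensionality_dep => -[l h]; rewrite /hat_map /glue /=.
case: eqVneq => [e|h']; first by exfalso; rewrite e eqxx in h.
by rewrite (bool_irrelevance h' h).
Qed.

Variable F : left_adjunction A.

(** The Yoneda morphism of [y]: morphisms out of [put (F j b) b] which are the
    identity off [j], up to [put_hat], amount to elements of [cohom F a j] for
    the tuples [a] with [hat j a = b]. *)
Definition classify a j (y : cohom F a j) :
    hom (put (F j (hat j a) : A j) (hat j a)) a :=
  let x : A j := F j (hat j a) in
  @glue (put x (hat j a)) a j ((y : hom x (a j)) \o put_at x (hat j a))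
    (put_hat x (hat j a)).

Lemma classify_at a j (y : cohom F a j) :
  classify y j =
  (y : hom (F j (hat j a) : A j) (a j)) \o put_at (F j (hat j a) : A j) _.
Proof. exact: glue_at. Qed.

Lemma classify_hat a j (y : cohom F a j) :
  hat_map j (classify y) = put_hat (F j (hat j a) : A j) (hat j a).
Proof. exact: glue_hat. Qed.

Lemma cohom_map_id_cohom a j (y : cohom F a j) :
  cohom_map (classify y) (id_cohom F (hat j a)) = y.
Proof.
rewrite /cohom_map /id_cohom classify_at classify_hat -!compmA.
rewrite -fmap_opM put_hatVK [X in _ \o X]compmA (put_atVK (A := A)) comp1m.
have -> : fmap_op (F j) (idm (hat j a)) = idm (F j (hat j a) : A j).
  exact: (fmap1 (F j)).
exact: compm1.
Qed.

End Yoneda.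

Section Mates.
Context {n : nat} {A A' : 'I_n.+1 -> category}.
Context (F : left_adjunction A) (F' : left_adjunction A').
Context (S : forall l, functor (A l) (A' l)).

(** By naturality in the tuple it suffices to take for [x] the counit, and
    there the square unfolds to the definition of the mate. *)
Lemma cell_act_mate i j (alpha : mate_cell F F' S i) (a : prod_cat A)
    (x : cohom F a i) :
  cell_act (mate alpha j) (transpose j x) = transpose j (cell_act alpha x).
Proof.
set y := transpose j x.
have -> : x = cohom_map (classify y) (counit F i (hat j a)).
  rewrite /counit -transpose_natural cohom_map_id_cohom /y.
  by rewrite transpose_trans transpose_id.
rewrite cell_act_natural transpose_natural.
rewrite /cell_act /cell_comp /= /mate_comp /cohom_map.
have -> : hat_map j (fmap (prod_functor S) (classify y)) =
          fmap (hat_functor S j) (put_hat (F j (hat j a) : A j) (hat j a)).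
  by rewrite -(classify_hat y).
by rewrite /= classify_at fmapM -!compmA.
Qed.

End Mates.

Theorem theorem2p16 (n : nat) (A A' : 'I_n.+1 -> category)
    (F : left_adjunction A) (F' : left_adjunction A')
    (S : forall l : 'I_n.+1, functor (A l) (A' l))
    (i j k : 'I_n.+1) (neq_ij : i != j) (neq_jk : j != k) (neq_ik : i != k)
    (alpha : mate_cell F F' S i) :
  mate (mate alpha j) k = mate alpha k.
Proof.
apply: nattrans_eq => b /=; rewrite /mate_comp.
have -> : counit F j b = transpose j (counit F i b).
  by rewrite /counit transpose_trans.
by rewrite cell_act_mate transpose_trans.
Qed.
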